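(* Let $\mathbb{F}$ be an algebraically closed field and let $A$ be an arbitrary unital locally matrix algebra over $\mathbb{F}$ of countable (i.e. countably infinite) dimension. Then there exists a general Cartan subalgebra of $A$ that is not a Cartan subalgebra of $A$.
   Context: An associative $\mathbb{F}$-algebra $A$ with unit $1$ is a unital locally matrix algebra if for every finite collection $a_1,\ldots,a_s\in A$ there is a subalgebra $A'\subset A$ with $1,a_1,\ldots,a_s\in A'$ and $A'\cong M_n(\mathbb{F})$ for some $n\ge1$. A subalgebra $H$ of the matrix algebra $M_n(\mathbb{F})$ is a Cartan subalgebra if $H\cong\mathbb{F}\oplus\cdots\oplus\mathbb{F}$ ($n$ summands), i.e. $H$ is spanned by $n$ pairwise orthogonal nonzero idempotents. A general Cartan subalgebra of $A$ is a subalgebra of the form $H=\bigcup_{i=1}^\infty H_i$, where $1\in A_1\subset A_2\subset\cdots$ is an ascending chain of subalgebras of $A$, each isomorphic to a matrix algebra $M_{n_i}(\mathbb{F})$, with $A=\bigcup_{i=1}^\infty A_i$, and $H_i$ is a Cartan subalgebra of $A_i$ for each $i$ with $1\in H_1\subset H_2\subset\cdots$. A decomposition $A=\bigotimes_{i=1}^\infty A_i$ into finite dimensional matrix algebras means: the $A_i$ are pairwise commuting subalgebras of $A$ containing $1$, each $A_i\cong M_{n_i}(\mathbb{F})$ for some $n_i\geq 1$, the multiplication maps $A_1\otimes_{\mathbb{F}}\cdots\otimes_{\mathbb{F}} A_k\to A$ are injective for all $k$, and $A$ is the union of their images. A subalgebra $H\subset A$ is called a Cartan subalgebra of $A$ if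 there exist such a decomposition and Cartan subalgebras $H_i$ of $A_i$ such that $H=\bigotimes_{i=1}^\infty H_i$, i.e. $H$ is the subalgebra of $A$ generated by all $H_i$. *)

(* Defs.v *)
From HB Require Import structures.
From mathcomp Require Import all_boot all_order all_algebra.
From mathcomp Require Import boolp classical_sets.
Set Implicit Arguments.
Unset Strict Implicit.
Unset Printing Implicit Defensive.
Import GRing.Theory.
Local Open Scope ring_scope.
Local Open Scope classical_set_scope.

Section LocallyMatrixAlgebras.
Variables (F : fieldType) (A : algType F).
Implicit Types (S H : set A).

(* 1 is not required to belong to a subalgebra: it is asked for separately. *)
Definition subalgebra S : Prop :=
  GRing.submod_closed [in S] /\ GRing.mulr_2closed [in S].

(* S is then automatically a subalgebra; its unit is f 1%:M, which is the unit
   of A as soon as 1 belongs to S. *)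
Definition isom_matrix_algebra (n : nat) S : Prop :=
  exists f : {linear 'M[F]_n -> A},
    [/\ injective f, {morph f : X Y / X *m Y >-> X * Y} & range f = S].

(* F + ... + F (n summands) is {ffun 'I_n -> F^o} with its pointwise product. *)
Definition isom_diagonal_algebra (n : nat) S : Prop :=
  exists f : {linear {ffun 'I_n -> F^o} -> A},
    [/\ injective f, {morph f : u v / u * v} & range f = S].

Definition matrix_subalgebra S : Prop :=
  exists2 n : nat, (0 < n)%N & isom_matrix_algebra n S.

Definition cartan_of_matrix_subalgebra S H : Prop :=
  exists n : nat, [/\ (0 < n)%N, isom_matrix_algebra n S, H `<=` S
                    & isom_diagonal_algebra n H].

Definition unital_locally_matrix : Prop :=
  forall s : seq A, exists S,
    [/\ S 1, (forall x, x \in s -> S x) & matrix_subalgebra S].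

Definition countably_infinite_dim : Prop :=
  exists e : nat -> A,
    (forall (n : nat) (c : 'I_n -> F),
        \sum_(i < n) c i *: e i = 0 -> forall i, c i = 0)
    /\ (forall x : A, exists (n : nat) (c : 'I_n -> F),
        x = \sum_(i < n) c i *: e i).

Definition general_cartan_subalgebra H : Prop :=
  exists A_ H_ : nat -> set A,
    [/\ [/\ A_ 0%N 1, (forall i, A_ i `<=` A_ i.+1),
            (forall i, matrix_subalgebra (A_ i)) & \bigcup_i A_ i = [set: A]],
        [/\ H_ 0%N 1, (forall i, H_ i `<=` H_ i.+1)
          & (forall i, cartan_of_matrix_subalgebra (A_ i) (H_ i))]
      & H = \bigcup_i H_ i].

(* The tensor product of the subspaces S 0, ..., S (k - 1) of A is described by
   its universal property.  Multilinear maps on S 0 x ... x S (k - 1) are encoded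
   as total functions on k-tuples of elements of A, whose values on tuples
   outside the product are irrelevant. *)
Definition multilinear_on (k : nat) (S : 'I_k -> set A) (W : lmodType F)
    (phi : ('I_k -> A) -> W) : Prop :=
  forall (a : 'I_k -> A) (i : 'I_k) (c : F) (x y : A),
    (forall j, S j (a j)) -> S i x -> S i y ->
    phi [eta a with i |-> c *: x + y] =
    c *: phi [eta a with i |-> x] + phi [eta a with i |-> y].

Definition is_tensor_product (k : nat) (S : 'I_k -> set A) (T : lmodType F)
    (t : ('I_k -> A) -> T) : Prop :=
  multilinear_on S t /\
  forall (W : lmodType F) (phi : ('I_k -> A) -> W), multilinear_on S phi ->
    let factors (g : {linear T -> W}) :=
      forall a : 'I_k -> A, (forall j, S j (a j)) -> g (t a) = phi a in
    (exists g, factors g) /\ (forall g1 g2, factors g1 -> factors g2 -> g1 =1 g2).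

Definition multiplication_map (k : nat) (S : 'I_k -> set A) (T : lmodType F)
    (m : {linear T -> A}) : Prop :=
  exists2 t : ('I_k -> A) -> T, is_tensor_product S t
    & forall a : 'I_k -> A, (forall j, S j (a j)) -> m (t a) = \prod_(j < k) a j.

(* T k is the tensor product of A_ 0, ..., A_ (k - 1). *)
Definition tensor_decomposition (A_ : nat -> set A) : Prop :=
  [/\ (forall i, A_ i 1),
      (forall i, matrix_subalgebra (A_ i)),
      (forall i j, i <> j ->
         forall x y, A_ i x -> A_ j y -> x * y = y * x)
    & exists (T : nat -> lmodType F) (m : forall k, {linear T k -> A}),
        [/\ forall k, multiplication_map (fun i : 'I_k => A_ i) (m k),
            forall k, injective (m k)
          & \bigcup_k range (m k) = [set: A]]].

Definition cartan_subalgebra H : Prop :=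
  exists A_ H_ : nat -> set A,
    [/\ tensor_decomposition A_,
        (forall i, cartan_of_matrix_subalgebra (A_ i) (H_ i))
      & H = smallest subalgebra (\bigcup_i H_ i)].

End LocallyMatrixAlgebras.

(* Main.v *)
(** If [H] is the tensor product of Cartan subalgebras of factors of [A], then for
    matrix units of one noncommutative factor the elements [u = e_01] and
    [v = e_10] satisfy [u^2 = 0], [u v <> 0] and [u H v] is contained in [H].
    A general Cartan subalgebra without such [u], [v] is built along an exhausting
    chain [A_0 < A_1 < ...] of matrix algebras.  If [e_jl] are units of [A_n]
    adapted to [H_n] and [C = M_k], [k > 1], is the centralizer of [A_n] in
    [A_(n+1)], then [H_(n+1)] is the sum of the [e_jj D_j] for Cartan subalgebras
    [D_j] of [C] that pairwise do not commute; [C] is realized below as the corner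
    [e_00 A_(n+1) e_00].  For [u], [v] in [A_n], the condition on [u H_n v] forces
    [u h v] to be a nonzero multiple of [e_jl h e_lj] for some [j <> l] and all [h]
    in [e_ll H], and at the next stage this carries [D_l] into [D_j]. *)

Require Import Defs.
From HB Require Import structures.
From mathcomp Require Import all_boot all_order all_algebra.
From mathcomp Require Import boolp classical_sets.

Set Implicit Arguments.
Unset Strict Implicit.
Unset Printing Implicit Defensive.
Import GRing.Theory.
Local Open Scope ring_scope.
Local Open Scope classical_set_scope.

(** Used mostly from right to left: a single term is spread into a sum over the index type, so that
    two sums can be compared termwise. *)
Lemma sum_if_eq (I : finType) (V : nmodType) (i : I) (G : I -> V) :
  \sum_j (if j == i then G j else 0) = G i.
Proof. by rewrite -big_mkcond big_pred1_eq. Qed.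

(** * Systems of matrix units, their spans and their diagonals *)

Section MatrixUnits.
Variables (F : fieldType) (A : algType F).

(** The index type is an arbitrary finite type because refined systems are indexed by products
    [I * 'I_k]. *)
Definition matrix_units (I : finType) (E : I -> I -> A) : Prop :=
  (forall i j k l, E i j * E k l = if j == k then E i l else 0)
  /\ \sum_i E i i = 1.

Definition units_span (I : finType) (E : I -> I -> A) : set A :=
  [set x | exists c : I -> I -> F, x = \sum_i \sum_j c i j *: E i j].

Definition diag_span (I : finType) (E : I -> I -> A) : set A :=
  [set x | exists c : I -> F, x = \sum_i c i *: E i i].

Section Theory.
Variables (I : finType) (E : I -> I -> A).
Hypothesis E_units : matrix_units E.

Let unitM := E_units.1.

Lemma unitMM i j k : E i j * E j k = E i k.
Proof. by rewrite unitM eqxx. Qed.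

(** If one unit vanished, so would every [E k k = E k i * E i j * E j k], and hence their sum 1. *)
Lemma unit_neq0 i j : E i j != 0.
Proof.
apply/eqP => Eij0; have /eqP[] : (1 : A) != 0 by exact: oner_neq0.
rewrite -E_units.2 big1 // => k _.
by rewrite -(unitMM k i k) -(unitMM i j k) Eij0 mul0r mulr0.
Qed.

Lemma units_inhabited : exists i : I, true.
Proof.
case: (pickP (@predT I)) => [i _|I0]; first by exists i.
have /eqP[] : (1 : A) != 0 by exact: oner_neq0.
by rewrite -E_units.2 big_pred0.
Qed.

Lemma unit_corner (c : I -> I -> F) a b i j :
  E a i * (\sum_i \sum_j c i j *: E i j) * E j b = c i j *: E a b.
Proof.
rewrite mulr_sumr mulr_suml -[RHS](sum_if_eq i (fun i => c i j *: E a b)).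
apply: eq_bigr => i' _; rewrite mulr_sumr mulr_suml.
rewrite -[RHS](sum_if_eq j (fun j => if i' == i then c i' j *: E a b else 0)).
apply: eq_bigr => j' _; rewrite -scalerAr -scalerAl unitM eq_sym.
case: eqP => _; last by rewrite mul0r scaler0 if_same.
by rewrite unitM; case: eqP => // _; rewrite scaler0.
Qed.

Lemma unit_decomp (x : A) : x = \sum_i \sum_j E i i * x * E j j.
Proof.
under eq_bigr do rewrite -mulr_sumr E_units.2 mulr1.
by rewrite -mulr_suml E_units.2 mul1r.
Qed.

Lemma units_span_unit i j : units_span E (E i j).
Proof.
exists (fun a b => if a == i then if b == j then 1 else 0 else 0).
rewrite -[LHS](sum_if_eq i (fun a => E a j)); apply: eq_bigr => a _.
case: eqP => _; last by rewrite big1 // => b _; rewrite scale0r.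
rewrite -[LHS](sum_if_eq j (fun b => E a b)); apply: eq_bigr => b _.
by case: eqP; rewrite ?scale1r ?scale0r.
Qed.

Lemma diag_span_unit i : diag_span E (E i i).
Proof.
exists (fun a => if a == i then 1 else 0).
rewrite -[LHS](sum_if_eq i (fun a => E a a)); apply: eq_bigr => a _.
by case: eqP; rewrite ?scale1r ?scale0r.
Qed.

Lemma diag_span1 : diag_span E 1.
Proof.
by exists (fun _ => 1); rewrite -E_units.2; under [RHS]eq_bigr do rewrite scale1r.
Qed.

Lemma sub_diag_span : diag_span E `<=` units_span E.
Proof.
move=> _ [c ->]; exists (fun i j => if j == i then c j else 0).
apply: eq_bigr => i _; rewrite -(sum_if_eq i (fun j => c j *: E i j)).
by apply: eq_bigr => j _; case: eqP; rewrite ?scale0r.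
Qed.

Lemma diag_spanM c d :
  (\sum_i c i *: E i i) * (\sum_i d i *: E i i) = \sum_i (c i * d i) *: E i i.
Proof.
rewrite mulr_suml; apply: eq_bigr => i _; rewrite mulr_sumr.
rewrite -(sum_if_eq i (fun j => (c i * d j) *: E i j)); apply: eq_bigr => j _.
rewrite -scalerAr -scalerAl unitM scalerA (mulrC (d j)) eq_sym.
by case: eqP => // _; rewrite scaler0.
Qed.

Lemma diag_span_comm x y : diag_span E x -> diag_span E y -> x * y = y * x.
Proof.
by move=> [c ->] [d ->]; rewrite !diag_spanM; under eq_bigr do rewrite mulrC.
Qed.

Lemma units_span_lin k x y :
  units_span E x -> units_span E y -> units_span E (k *: x + y).
Proof.
move=> [c ->] [d ->]; exists (fun i j => k * c i j + d i j).
rewrite scaler_sumr -big_split; apply: eq_bigr => i _ /=.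
rewrite scaler_sumr -big_split; apply: eq_bigr => j _ /=.
by rewrite scalerDl scalerA.
Qed.

Lemma units_span0 : units_span E 0.
Proof.
by exists (fun _ _ => 0); rewrite big1 // => i _; rewrite big1 // => j _; rewrite scale0r.
Qed.

Lemma units_span_sum (J : finType) (G : J -> A) :
  (forall j, units_span E (G j)) -> units_span E (\sum_j G j).
Proof.
move=> EG; apply: (big_ind (units_span E)) => // [|x y Ex Ey].
  exact: units_span0.
by rewrite -[x]scale1r; apply: units_span_lin.
Qed.

End Theory.

(** * Passage between systems of matrix units and matrix subalgebras *)

Section UnitsMorphism.
Variables (I : finType) (E : I -> I -> A).

(** Matrices have ordinal indices; [enum_rank] identifies [I] with ['I_#|I|]. *)
Definition units_mx (X : 'M[F]_#|I|) : A :=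
  \sum_i \sum_j X (enum_rank i) (enum_rank j) *: E i j.

Lemma units_mx_is_linear : linear units_mx.
Proof.
move=> k X Y; rewrite /units_mx scaler_sumr -big_split; apply: eq_bigr => i _ /=.
rewrite scaler_sumr -big_split; apply: eq_bigr => j _ /=.
by rewrite !mxE scalerDl scalerA.
Qed.
HB.instance Definition _ :=
  GRing.isLinear.Build F 'M[F]_#|I| A _ units_mx units_mx_is_linear.

Definition units_diag (u : {ffun 'I_#|I| -> F^o}) : A :=
  \sum_i u (enum_rank i) *: E i i.

Lemma units_diag_is_linear : linear units_diag.
Proof.
move=> k u v; rewrite /units_diag scaler_sumr -big_split; apply: eq_bigr => i _ /=.
by rewrite !ffunE scalerDl scalerA.
Qed.
HB.instance Definition _ :=
  GRing.isLinear.Build F {ffun 'I_#|I| -> F^o} A _ units_diag units_diag_is_linear.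

Hypothesis E_units : matrix_units E.

Lemma cartan_of_units :
  cartan_of_matrix_subalgebra (units_span E) (diag_span E).
Proof.
have unitM := E_units.1.
have [i0 _] := units_inhabited E_units.
exists #|I|; split; first by apply/card_gt0P; exists i0.
- exists units_mx; split.
  + move=> X Y eqXY; apply/matrixP => i j.
    have /eqP := congr1 (fun z => E i0 (enum_val i) * z * E (enum_val j) i0) eqXY.
    rewrite /= /units_mx !unit_corner // !enum_valK -subr_eq0 -scalerBl.
    by rewrite scaler_eq0 (negPf (unit_neq0 E_units _ _)) orbF subr_eq0 => /eqP.
  + move=> X Y; rewrite /= [LHS]/units_mx mulr_suml; apply: eq_bigr => i _.
    rewrite mulr_suml.
    under eq_bigr => j _.
      rewrite !mxE scaler_suml; over.
    rewrite exchange_big /= (reindex enum_rank) /=; last first.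
      by apply: onW_bij; apply: enum_rank_bij.
    apply: eq_bigr => k _; rewrite /units_mx mulr_sumr.
    rewrite -(sum_if_eq k (fun l => \sum_j _)).
    apply: eq_bigr => l _; rewrite mulr_sumr; case: eqP => [->|kl].
      by apply: eq_bigr => j _; rewrite -scalerAr -scalerAl unitMM // scalerA mulrC.
    rewrite big1 // => j _; rewrite -scalerAr -scalerAl unitM.
    by rewrite eq_sym; case: eqP => // _; rewrite !scaler0.
  + apply/seteqP; split=> [_ [X _ <-]|_ [c ->]]; first by eexists.
    exists (\matrix_(i, j) c (enum_val i) (enum_val j)) => //=.
    apply: eq_bigr => i _; apply: eq_bigr => j _.
    by rewrite mxE !enum_rankK.
- exact: sub_diag_span.
- exists units_diag; split.
  + move=> u v equv; apply/ffunP => i.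
    have /eqP := congr1 (fun z => E i0 (enum_val i) * z) equv.
    have diagE w : E i0 (enum_val i) * units_diag w = w i *: E i0 (enum_val i).
      rewrite -[in w i](enum_valK i) /units_diag mulr_sumr.
      rewrite -(sum_if_eq (enum_val i) (fun j => w (enum_rank j) *: E i0 j)).
      apply: eq_bigr => j _; rewrite -scalerAr unitM eq_sym.
      by case: eqP => // _; rewrite scaler0.
    rewrite /= !diagE -subr_eq0 -scalerBl.
    by rewrite scaler_eq0 (negPf (unit_neq0 E_units _ _)) orbF subr_eq0 => /eqP.
  + move=> u v; rewrite /= /units_diag diag_spanM //.
    by apply: eq_bigr => i _; rewrite ffunE.
  + apply/seteqP; split=> [_ [u _ <-]|_ [c ->]].
      by exists (fun i => u (enum_rank i)).
    exists [ffun i => c (enum_val i)] => //=.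
    by apply: eq_bigr => i _; rewrite ffunE enum_rankK.
Qed.

End UnitsMorphism.

Section FromMatrices.
Variables (n : nat) (f : {linear 'M[F]_n -> A}).
Hypothesis fM : {morph f : X Y / X *m Y >-> X * Y}.

(** The image of the identity matrix is a unit for the range of [f]; as 1 lies in that range, the
    two units agree. *)
Lemma morph_mx1 : range f 1 -> f 1%:M = 1.
Proof. by case=> X _ fX; rewrite -[RHS]fX -[X in RHS]mul1mx fM fX mulr1. Qed.

Lemma morph_mxE X : f X = \sum_i \sum_j X i j *: f (delta_mx i j).
Proof.
rewrite {1}(matrix_sum_delta X) linear_sum; apply: eq_bigr => i _.
by rewrite linear_sum; apply: eq_bigr => j _; rewrite linearZ_LR.
Qed.

Lemma matrix_units_of_morph : f 1%:M = 1 ->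
  matrix_units (fun i j => f (delta_mx i j)).
Proof.
move=> f1; split=> [i j k l|].
  by rewrite -fM mul_delta_mx_cond; case: eqP => _; rewrite ?mulr1n ?mulr0n ?raddf0.
by rewrite -linear_sum -mx1_sum_delta f1.
Qed.

Lemma units_span_of_morph : units_span (fun i j => f (delta_mx i j)) = range f.
Proof.
apply/seteqP; split=> [_ [c ->]|_ [X _ <-]].
  exists (\matrix_(i, j) c i j) => //; rewrite morph_mxE.
  by apply: eq_bigr => i _; apply: eq_bigr => j _; rewrite mxE.
by rewrite morph_mxE; exists X.
Qed.

End FromMatrices.

Lemma matrix_units_matrix_subalgebra (S : set A) : S 1 -> matrix_subalgebra S ->
  exists (I : finType) (E : I -> I -> A), matrix_units E /\ units_span E = S.
Proof.
move=> S1 [n _ [f [_ fM fS]]]; exists 'I_n, (fun i j => f (delta_mx i j)).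
split; last by rewrite units_span_of_morph.
by apply: matrix_units_of_morph => //; apply: morph_mx1; rewrite ?fS.
Qed.

Lemma matrix_subalgebraM (S : set A) x y :
  matrix_subalgebra S -> S x -> S y -> S (x * y).
Proof. by move=> [n _ [f [_ fM <-]]] [X _ <-] [Y _ <-]; exists (X *m Y). Qed.

(** * The singular step: refining a system of units by pairwise noncommuting diagonals *)

Section Corner.
Variables (I : finType) (E : I -> I -> A) (E_units : matrix_units E).
Variables (T : set A) (T_matrix : matrix_subalgebra T).
Hypotheses (ET : units_span E `<=` T) (TE : ~ (T `<=` units_span E)).

(* With e = g p and p = C R the rank factorization of the idempotent p, the map
   X |-> C X R is an isomorphism from M_k onto p M_m p, where k = rank p; and
   k = 1 would force T to be the span of E. *)
Lemma corner_matrix_algebra (i0 : I) :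
  exists (k : nat) (f : {linear 'M[F]_k -> A}),
  [/\ (1 < k)%N, injective f, {morph f : X Y / X *m Y >-> X * Y},
      f 1%:M = E i0 i0 & forall t, T t -> range f (E i0 i0 * t * E i0 i0)].
Proof.
have [m _ [g [g_inj gM gT]]] := T_matrix.
have [p _ gp] : range g (E i0 i0) by rewrite gT; apply: ET; apply: units_span_unit.
have [C [R [C_full R_free CR]]] : exists (C : 'M_(m, \rank p)) (R : 'M_(\rank p, m)),
    [/\ row_full C, row_free R & C *m R = p].
  exists (col_base p), (row_base p).
  by rewrite col_base_full row_base_free mulmx_base.
(* Since [p] is idempotent, [C R C R = C R]; full rank allows cancelling [C] on the left and [R] on
   the right. *)
have RC : R *m C = 1%:M.
  have pp : p *m p = p by apply: g_inj; rewrite gM gp unitMM.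
  apply: (row_free_inj R_free); apply: (row_full_inj C_full).
  by rewrite mul1mx !mulmxA CR -mulmxA CR.
pose f : {linear 'M[F]_(\rank p) -> A} := g \o (mulmxr R \o mulmx C).
have fE X : f X = g (C *m X *m R) by [].
have f_inj : injective f.
  have fK X : R *m (C *m X *m R) *m C = X.
    by rewrite !mulmxA RC mul1mx -mulmxA RC mulmx1.
  by move=> X Y /g_inj/= eqXY; rewrite -[X]fK -[Y]fK eqXY.
have fM : {morph f : X Y / X *m Y >-> X * Y}.
  move=> X Y; rewrite !fE -gM; congr (g _).
  by rewrite -!mulmxA [R *m (C *m _)]mulmxA RC mul1mx.
have f1 : f 1%:M = E i0 i0 by rewrite fE mulmx1 CR.
have f_corner t : T t -> range f (E i0 i0 * t * E i0 i0).
  rewrite -gT => -[Y _ <-]; exists (R *m Y *m C) => //.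
  by rewrite fE -gp -!gM; congr (g _); rewrite !mulmxA CR -!mulmxA CR.
exists (\rank p), f; split=> //.
have p_neq0 : p != 0.
  apply: contra_neq (unit_neq0 E_units i0 i0) => p0.
  by rewrite -gp p0 raddf0.
have rank_gt0 : (0 < \rank p)%N by rewrite lt0n mxrank_eq0.
rewrite ltn_neqAle rank_gt0 andbT; apply/eqP => rank1; apply: TE => t Tt.
rewrite (unit_decomp E_units t); apply: units_span_sum => // i.
apply: units_span_sum => // j.
(* The block [E i i * t * E j j] is moved into the corner at [i0], where for rank 1 everything is
   scalar, and then moved back. *)
have [|X _ fX] := f_corner (E i0 i * t * E j i0).
  by apply: (matrix_subalgebraM T_matrix (matrix_subalgebraM T_matrix _ Tt)); apply: ET; apply: units_span_unit.
have [c Xc] : exists c, X = c *: 1%:M.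
  exists (X (Ordinal rank_gt0) (Ordinal rank_gt0)); apply/matrixP => a b.
  have ord_eq (x : 'I_(\rank p)) : x = Ordinal rank_gt0.
    by apply/val_inj; case: x => -[|x] //= xp; rewrite -rank1 in xp.
  by rewrite !mxE [a]ord_eq [b]ord_eq eqxx mulr1.
have -> : E i i * t * E j j = c *: E i j.
  rewrite -(unitMM E_units i i0 i) -(unitMM E_units j i0 j).
  rewrite -(unitMM E_units i i0 i0) -(unitMM E_units i0 i0 j) -!mulrA.
  rewrite [X in E i i0 * X](_ : _ = (E i0 i0 * (E i0 i * t * E j i0) * E i0 i0) * E i0 j).
    by rewrite -fX Xc linearZ_LR f1 /= -scalerAl -scalerAr !unitMM.
  by rewrite -!mulrA.
rewrite -[_ *: _]addr0; apply: units_span_lin.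
  exact: units_span_unit.
exact: units_span0.
Qed.

End Corner.

(** Conjugating [D = e_00] by the transvections [1 + w_i N], where [N = e_01], gives idempotents
    [q_i = D - w_i N] with [q_i q_j = q_j]. They commute only if [w_i = w_j]. *)
Lemma noncommuting_conjugates (I : finType) (w : I -> F) (k : nat) :
  injective w -> (1 < k)%N ->
  exists (P Q : I -> 'M[F]_k) (a : 'I_k),
    (forall i, P i *m Q i = 1%:M /\ Q i *m P i = 1%:M) /\
    forall i j, i != j ->
      let q i := P i *m delta_mx a a *m Q i in q i *m q j != q j *m q i.
Proof.
case: k => [|[|k]] // w_inj _.
pose D : 'M[F]_k.+2 := delta_mx ord0 ord0.
pose N : 'M[F]_k.+2 := delta_mx ord0 (lift ord0 ord0).
have DD : D * D = D by exact: mul_delta_mx.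
have DN : D * N = N by exact: mul_delta_mx.
have ND : N * D = 0 by exact: mul_delta_mx_0.
have NN : N * N = 0 by exact: mul_delta_mx_0.
have mulZ (x y : F) : (1 + x *: N) * (1 + y *: N) = 1 + (x + y) *: N.
  rewrite mulrDl mul1r mulrDr mulr1 -scalerAl -scalerAr NN !scaler0 addr0.
  by rewrite -addrA -scalerDl (addrC y).
exists (fun i => 1 + w i *: N), (fun i => 1 + (- w i) *: N), ord0; split.
  by move=> i; split; apply: etrans (mulZ _ _) _; rewrite (addrN, addNr) scale0r addr0.
move=> i j ij /=; set q := fun l => (1 + w l *: N) *m D *m (1 + (- w l) *: N).
rewrite -/(q i) -/(q j).
have qE l : q l = D - w l *: N.
  rewrite /q -/D -![_ *m _]/(_ * _) mulrDl mul1r -scalerAl ND scaler0 addr0.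
  by rewrite mulrDr mulr1 -scalerAr DN scaleNr.
have qM l m : q l *m q m = D - w m *: N.
  rewrite !qE -[_ *m _]/(_ * _) mulrBl !mulrBr DD -!scalerAr DN -!scalerAl ND NN.
  by rewrite !scaler0 subrr subr0.
rewrite !qM (inj_eq (addrI _)) (inj_eq oppr_inj) -subr_eq0 -scalerBl scaler_eq0.
rewrite negb_or subr_eq0 (inj_eq w_inj) eq_sym ij; apply/eqP => /matrixP.
by move=> /(_ ord0 (lift ord0 ord0)) /eqP; rewrite !mxE !eqxx oner_eq0.
Qed.

(** The last clause says that conjugation by [E j l] does not carry the corner of the new diagonal
    at [l] into the corner at [j]. It is phrased as a failure of commutation because that persists
    in every larger commutative algebra, in particular in the union of all later diagonals. *)
Definition singular_step (I I' : finType) (E : I -> I -> A) (E' : I' -> I' -> A) :=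
  [/\ units_span E `<=` units_span E', diag_span E `<=` diag_span E'
    & forall j l, j != l -> exists x y,
        [/\ diag_span E' x, diag_span E' y, E l l * x * E l l = x
          & E j l * x * E l j * y <> y * (E j l * x * E l j)]].

Section Step.
Variables (I : finType) (E : I -> I -> A) (E_units : matrix_units E).
Variables (T : set A) (T_matrix : matrix_subalgebra T).
Hypotheses (ET : units_span E `<=` T) (TE : ~ (T `<=` units_span E)).
Variables (w : I -> F) (w_inj : injective w).

Lemma singular_step_exists :
  exists (I' : finType) (E' : I' -> I' -> A),
    [/\ matrix_units E', singular_step E E' & T `<=` units_span E'].
Proof.
have unitM := E_units.1.
have [i0 _] := units_inhabited E_units.
have [k [f [k_gt1 f_inj fM f1 f_corner]]] := corner_matrix_algebra E_units T_matrix ET TE i0.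
have [P [Q [a0 [PQ q_comm]]]] := noncommuting_conjugates w_inj k_gt1.
have f1l X : E i0 i0 * f X = f X by rewrite -f1 -fM mul1mx.
have f1r X : f X * E i0 i0 = f X by rewrite -f1 -fM mulmx1.
(* [G i j X] moves the element [f X] of the corner at [i0] to the block [(i, j)]. The units [U]
   below twist block [i] by [P i], so that the diagonal there becomes the conjugate of the standard
   one by [P i]. *)
pose G i j X := E i i0 * f X * E i0 j.
have GM i j k' l X Y : G i j X * G k' l Y = if j == k' then G i l (X *m Y) else 0.
  rewrite /G -!mulrA (mulrA (E i0 j)) unitM; case: eqP => _; last by rewrite mul0r !mulr0.
  by rewrite (mulrA (E i0 i0)) f1l (mulrA (f X)) -fM.
pose U (x y : I * 'I_k) := G x.1 y.1 (P x.1 *m delta_mx x.2 y.2 *m Q y.1).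
have G_sum i j (J : finType) (X : J -> 'M_k) : G i j (\sum_a X a) = \sum_a G i j (X a).
  by rewrite /G linear_sum mulr_sumr mulr_suml.
have G1 i : G i i 1%:M = E i i by rewrite /G f1 !unitMM.
have diag_sum i : \sum_a U (i, a) (i, a) = E i i.
  rewrite /U /= -G_sum -mulmx_suml -mulmx_sumr -mx1_sum_delta mulmx1.
  by rewrite (PQ i).1 G1.
have UM x y z t : U x y * U z t = if y == z then U x t else 0.
  case: x y z t => [i a] [j b] [j' b'] [l c]; rewrite /U GM /= xpair_eqE.
  case: eqP => //= <-; rewrite -!mulmxA (mulmxA (Q j)) (PQ j).2 mul1mx.
  rewrite (mulmxA (delta_mx a b)) mul_delta_mx_cond.
  by case: eqP => _; rewrite ?mulr1n // mulr0n mul0mx mulmx0 /G raddf0 mulr0 mul0r.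
have U_units : matrix_units U.
  split=> //; rewrite -E_units.2 -(eq_bigr _ (fun i _ => diag_sum i)).
  by rewrite pair_bigA; apply: eq_bigr => -[].
have TU : T `<=` units_span U.
  move=> t Tt; rewrite (unit_decomp E_units t).
  apply: units_span_sum => // i; apply: units_span_sum => // j.
  have [|X _ fX] := f_corner (E i0 i * t * E j i0).
    by apply: (matrix_subalgebraM T_matrix (matrix_subalgebraM T_matrix _ Tt)); apply: ET; apply: units_span_unit.
  (* Writing [X] as [P i *m Y *m Q j] undoes the twist: the entries of [Y] are the coefficients with
     respect to [U]. *)
  have -> : E i i * t * E j j = G i j (P i *m (Q i *m X *m P j) *m Q j).
    rewrite !mulmxA (PQ i).1 mul1mx -mulmxA (PQ j).1 mulmx1 /G fX.
    by rewrite !mulrA unitMM // -!mulrA unitMM // !mulrA unitMM // -!mulrA unitMM.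
  set Y := Q i *m X *m P j; rewrite (matrix_sum_delta Y) mulmx_sumr mulmx_suml G_sum.
  apply: units_span_sum => // a; rewrite mulmx_sumr mulmx_suml G_sum.
  apply: units_span_sum => // b.
  have -> : G i j (P i *m (Y a b *: delta_mx a b) *m Q j) = Y a b *: U (i, a) (j, b) + 0.
    by rewrite addr0 -scalemxAr -scalemxAl /G linearZ_LR /= -scalerAr -scalerAl.
  by apply: units_span_lin; [apply: units_span_unit|apply: units_span0].
exists (I * 'I_k)%type, U; split=> //; split.
- exact: subset_trans TU.
- move=> _ [c ->]; exists (fun x => c x.1).
  under eq_bigr do rewrite -diag_sum scaler_sumr.
  by rewrite pair_bigA; apply: eq_bigr => -[].
(* Both witnesses are the twisted units at [a0]. Transported from block [l] to block [j], the first
   becomes [q l], while the second is [q j]. *)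
- move=> j l jl; exists (U (l, a0) (l, a0)), (U (j, a0) (j, a0)); split.
  + exact: diag_span_unit.
  + exact: diag_span_unit.
  + rewrite /U /G /=.
    by rewrite !mulrA unitMM // -!mulrA unitMM.
  + set q := fun i => P i *m delta_mx a0 a0 *m Q i.
    rewrite (_ : E j l * _ * _ = G j j (q l)); last first.
      by rewrite /U /G /= !mulrA unitMM // -!mulrA unitMM.
    rewrite /U /= -/(q j) !GM eqxx => eqG.
    have /f_inj eqf : f (q l *m q j) = f (q j *m q l).
      have GK X : E i0 j * G j j X * E j i0 = f X.
        by rewrite /G !mulrA unitMM // f1l -mulrA unitMM // f1r.
      by rewrite -[LHS]GK eqG GK.
    by rewrite eq_sym in jl; have /eqP := q_comm _ _ jl; apply.
Qed.

End Step.

(** * The union of the diagonals along a singular chain *)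

Section SingularUnion.
Variables (I_ : nat -> finType) (E_ : forall n, I_ n -> I_ n -> A).
Hypotheses (E_units : forall n, matrix_units (@E_ n)).
Hypothesis E_step : forall n, singular_step (@E_ n) (@E_ n.+1).
Hypothesis E_full : \bigcup_n units_span (@E_ n) = [set: A].

Let H := \bigcup_n diag_span (@E_ n).

Lemma units_span_mono m n : (m <= n)%N -> units_span (@E_ m) `<=` units_span (@E_ n).
Proof.
elim: n => [|n IHn]; first by rewrite leqn0 => /eqP ->.
rewrite leq_eqVlt => /predU1P[-> //|]; rewrite ltnS => /IHn mn.
by apply: subset_trans mn _; have [] := E_step n.
Qed.

Lemma diag_span_mono m n : (m <= n)%N -> diag_span (@E_ m) `<=` diag_span (@E_ n).
Proof.
elim: n => [|n IHn]; first by rewrite leqn0 => /eqP ->.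
rewrite leq_eqVlt => /predU1P[-> //|]; rewrite ltnS => /IHn mn.
by apply: subset_trans mn _; have [] := E_step n.
Qed.

Lemma general_cartan_of_units : general_cartan_subalgebra H.
Proof.
exists (fun n => units_span (@E_ n)), (fun n => diag_span (@E_ n)); split=> //.
  split=> // [|n|n].
  - by apply: sub_diag_span; apply: diag_span1.
  - by have [] := E_step n.
  - by have [k [k_gt0 ? _ _]] := cartan_of_units (E_units n); exists k.
split=> [|n|n]; first exact: diag_span1.
- by have [] := E_step n.
- exact: cartan_of_units.
Qed.

Lemma diag_union_comm x y : H x -> H y -> x * y = y * x.
Proof.
move=> [m _ Hx] [n _ Hy]; apply: (diag_span_comm (E_units (maxn m n))).
  exact: (diag_span_mono (leq_maxl m n)).
exact: (diag_span_mono (leq_maxr m n)).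
Qed.

(* H being commutative, u E_ll v is diagonal; as it has rank at most one, it is
   a multiple of some E_jj, so u E_ll and E_ll v are multiples of E_jl and E_lj.
   Then u x v = c E_jl x E_lj for x in E_ll H E_ll, against the choice of the
   next stage. *)
Lemma diag_union_rigid (u v : A) : u * u = 0 -> u * v != 0 ->
  ~ (forall h, H h -> H (u * h * v)).
Proof.
move=> uu uv uHv.
have [mu _ u_mu] : (\bigcup_n units_span (@E_ n)) u by rewrite E_full.
have [mv _ v_mv] : (\bigcup_n units_span (@E_ n)) v by rewrite E_full.
pose n := maxn mu mv.
have {u_mu} [c uE] := units_span_mono (leq_maxl mu mv) u_mu.
have {v_mv} [d vE] := units_span_mono (leq_maxr mu mv) v_mv.
have [_ _ step] := E_step n.
rewrite -/n in c uE d vE; pose E := @E_ n.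
have E_unit : matrix_units E by exact: E_units.
have cE a i j b : E a i * u * E j b = c i j *: E a b by rewrite uE unit_corner.
have dE a i j b : E a i * v * E j b = d i j *: E a b by rewrite vE unit_corner.
have HE i : H (E i i) by exists n => //; apply: diag_span_unit.
have [l uv_l] : exists l, u * E l l * v != 0.
  apply: contrapT => uv0; case/eqP: uv; rewrite -[u]mulr1 -E_unit.2 mulr_sumr mulr_suml.
  by apply: big1 => l _; apply/eqP; apply: contrapT => /negP; apply: contra_not uv0; exists l.
have corner a b : E a a * (u * E l l * v) * E b b = (c a l * d l b) *: E a b.
  rewrite -(unitMM E_unit l l l) !mulrA cE -!mulrA (mulrA (E l l)) dE.
  by rewrite -scalerAl -scalerAr unitMM // scalerA.
have off a b : a != b -> c a l * d l b = 0.
  move=> ab; have := corner a b.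
  rewrite -mulrA (diag_union_comm (uHv _ (HE l)) (HE b)) mulrA E_unit.1 (negPf ab) mul0r.
  by move/esym/eqP; rewrite scaler_eq0 (negPf (unit_neq0 E_unit _ _)) orbF => /eqP.
have [j cd_j] : exists j, c j l * d l j != 0.
  apply: contrapT => cd0; case/eqP: uv_l; rewrite (unit_decomp E_unit (u * E l l * v)).
  apply: big1 => a _; apply: big1 => b _; rewrite corner.
  have [<-|/off ->] := eqVneq a b; last by rewrite scale0r.
  have [->|cd] := eqVneq (c a l * d l a) 0; first by rewrite scale0r.
  by case: cd0; exists a.
have [c_j d_j] : c j l != 0 /\ d l j != 0 by apply/andP; rewrite -negb_or -mulf_eq0.
have uEl : u * E l l = c j l *: E j l.
  rewrite -[u]mul1r -E_unit.2 !mulr_suml -(sum_if_eq j (fun a => c a l *: E a l)).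
  apply: eq_bigr => a _; rewrite cE; case: eqP => // /eqP aj.
  by have /eqP := off a j aj; rewrite mulf_eq0 (negPf d_j) orbF => /eqP ->; rewrite scale0r.
have Elv : E l l * v = d l j *: E l j.
  rewrite -[v]mulr1 -E_unit.2 !mulr_sumr -(sum_if_eq j (fun b => d l b *: E l b)).
  apply: eq_bigr => b _; rewrite mulrA dE; case: eqP => // /eqP bj.
  have := off j b; rewrite eq_sym => /(_ bj)/eqP.
  by rewrite mulf_eq0 (negPf c_j) => /eqP ->; rewrite scale0r.
(* For [j = l], [E l l] would be an eigenvector of left multiplication by [u] with nonzero
   eigenvalue, against [u * u = 0]. *)
have jl : j != l.
  apply: contraNneq c_j => jl; rewrite jl in uEl *.
  have /eqP : u * u * E l l = 0 by rewrite uu mul0r.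
  rewrite -mulrA uEl -scalerAr uEl scalerA scaler_eq0 (negPf (unit_neq0 E_unit _ _)).
  by rewrite orbF mulf_eq0 orbb.
have [x [y [Dx Dy xE []]]] := step _ _ jl.
have Hx : H x by exists n.+1.
have Hy : H y by exists n.+1.
have uxv : u * x * v = (c j l * d l j) *: (E j l * x * E l j).
  by rewrite -[in LHS]xE !mulrA uEl -!mulrA Elv -!scalerAl -!scalerAr scalerA !mulrA.
have := diag_union_comm (uHv _ Hx) Hy.
by rewrite uxv -scalerAl -scalerAr => /(scalerI cd_j).
Qed.

End SingularUnion.

(** * An exhausting chain of singular steps *)

Lemma matrix_subalgebra_proper (S : set A) :
  countably_infinite_dim A -> matrix_subalgebra S -> ~ ([set: A] `<=` S).
Proof.
move=> [e [e_free _]] [n _ [f [_ _ fS]]] full.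
have [X fX] : {X : nat -> 'M[F]_n & forall i, f (X i) = e i}.
  apply: (@choice _ _ (fun i X => f X = e i)) => i.
  have : S (e i) by exact: full.
  by rewrite -fS => -[Y _ <-]; exists Y.
(* [N] exceeds the dimension of the matrix algebra by one, so the rows of [M] are dependent; a
   nonzero row of the left kernel is a dependency among the first [N] basis vectors. *)
pose N := (n * n).+1; pose M : 'M[F]_(N, n * n) := \matrix_(i < N) mxvec (X i).
have ker_neq0 : kermx M != 0.
  rewrite kermx_eq0; apply/negP => /eqP rankM.
  by have := rank_leq_col M; rewrite rankM ltnn.
have := ker_neq0; rewrite -nz_row_eq0 => /negP[]; apply/eqP/rowP => i; rewrite mxE.
have : nz_row (kermx M) *m M = 0 by apply/sub_kermxP; apply: nz_row_sub.
set r := nz_row _ => rM; apply: (e_free N (fun i => r 0 i)) i.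
under eq_bigr do rewrite -fX -linearZ_LR.
rewrite -linear_sum -[RHS](raddf0 f); congr (f _).
apply: (can_inj mxvecK); rewrite linear0 -rM mulmx_sum_row linear_sum.
by apply: eq_bigr => i _; rewrite linearZ_LR rowK.
Qed.

Lemma units_span_chain :
  (forall I : finType, exists f : I -> F, injective f) ->
  unital_locally_matrix A -> countably_infinite_dim A ->
  exists (I_ : nat -> finType) (E_ : forall n, I_ n -> I_ n -> A),
    [/\ forall n, matrix_units (@E_ n), forall n, singular_step (@E_ n) (@E_ n.+1)
      & \bigcup_n units_span (@E_ n) = [set: A]].
Proof.
move=> F_infinite A_matrix A_dim; have [e [_ e_span]] := A_dim.
(* Index type and units are packed together, so that one choice function on pairs of a stage number
   and a system yields the whole chain. *)
pose system := {I : finType & {E : I -> I -> A | matrix_units E}}.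
pose mat (s : system) := sval (projT2 s).
have mat_units s : matrix_units (mat s) := svalP (projT2 s).
have [s0] : exists s : system, True.
  have [S [S1 _ S_matrix]] := A_matrix [::].
  have [I [E [EU _]]] := matrix_units_matrix_subalgebra S1 S_matrix.
  by exists (existT _ I (exist _ E EU)).
have next (p : nat * system) : exists s : system,
    singular_step (mat p.2) (mat s) /\ units_span (mat s) (e p.1).
  case: p => n s /=; have E_units := mat_units s.
  have E_matrix : matrix_subalgebra (units_span (mat s)).
    by have [k [k_gt0 ? _ _]] := cartan_of_units E_units; exists k.
  have [z Ez] : exists z, ~ units_span (mat s) z.
    apply: contrapT => noz; apply: (matrix_subalgebra_proper A_dim E_matrix) => z _.
    by apply: contrapT => Ez; apply: noz; exists z.
  (* The basis vector [e n] makes the chain exhaust the algebra, [z] makes the inclusion strict, and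
     the old units keep the old span inside [T]. *)
  pose gens := [:: e n; z] ++ [seq mat s i.1 i.2 | i <- enum {: tag s * tag s}].
  have [T [T1 gensT T_matrix]] := A_matrix gens.
  have [J [G [G_units GT]]] := matrix_units_matrix_subalgebra T1 T_matrix.
  have ET : units_span (mat s) `<=` T.
    move=> _ [c ->]; rewrite -GT; apply: units_span_sum => i; apply: units_span_sum => j.
    rewrite -[_ *: _]addr0; apply: units_span_lin; last exact: units_span0.
    rewrite GT; apply: gensT; rewrite mem_cat; apply/orP; right.
    by apply/mapP; exists (i, j); rewrite ?mem_enum.
  have TE : ~ (T `<=` units_span (mat s)).
    by apply: contra_not Ez; apply; apply: gensT; rewrite !inE eqxx orbT.
  have [f f_inj] := F_infinite (tag s).
  have [I' [E' [E'_units step TE']]] := singular_step_exists E_units T_matrix ET TE f_inj.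
  exists (existT _ I' (exist _ E' E'_units)); split=> //.
  by apply: TE'; apply: gensT; rewrite !inE eqxx.
move=> _; have [g gP] := choice next.
pose s := fix s n := if n is m.+1 then g (m, s m) else s0.
exists (fun n => tag (s n)), (fun n => mat (s n)).
have step n : singular_step (mat (s n)) (mat (s n.+1)) by have [] := gP (n, s n).
split=> //.
(* The vector [e i] is absorbed at stage [i.+1], so stage [n] contains every combination of the
   first [n] basis vectors. *)
apply/seteqP; split=> // x _; have [n [c ->]] := e_span x; exists n => //.
apply: (big_ind (units_span (mat (s n)))) => [|y z Ey Ez|i _].
- exact: units_span0.
- by rewrite -[y]scale1r; apply: units_span_lin.
- rewrite -[_ *: _]addr0; apply: units_span_lin; last exact: units_span0.
  have mono := @units_span_mono (fun n => tag (s n)) (fun n => mat (s n)) step.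
  by apply: (mono _ _ (ltn_ord i)); have [] := gP (nat_of_ord i, s i).
Qed.

(** * Matrix units adapted to a Cartan subalgebra of a matrix algebra *)

Lemma cartan_units (S H : set A) : S 1 -> cartan_of_matrix_subalgebra S H ->
  exists (n : nat) (E : 'I_n -> 'I_n -> A),
    [/\ matrix_units E, units_span E = S & diag_span E = H].
Proof.
move=> S1 [n [n_gt0 [f [f_inj fM fS]] HS [g [g_inj gM gH]]]].
pose dirac i : {ffun 'I_n -> F^o} := [ffun j => (j == i)%:R].
have diracM i j : dirac i * dirac j = if i == j then dirac i else 0.
  apply/ffunP => k; rewrite !ffunE; case: (eqVneq i j) => [->|ij].
    by rewrite !ffunE -natrM mulnb andbb.
  rewrite ffunE; case: (eqVneq k i) => [->|_]; last by rewrite mul0r.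
  by rewrite (negPf ij) mulr0.
have /fin_all_exists[e fe] i : exists X, f X = g (dirac i).
  have : S (g (dirac i)) by apply: HS; rewrite -gH; exists (dirac i).
  by rewrite -fS => -[X _ fX]; exists X.
have eM i j : e i *m e j = if i == j then e i else 0.
  by apply: f_inj; rewrite fM !fe -gM diracM; case: eqP => _; rewrite ?fe // !raddf0.
have e_neq0 i : e i != 0.
  apply/eqP => ei0; have : g (dirac i) = g 0 by rewrite -fe ei0 !raddf0.
  by move/g_inj/ffunP/(_ i)/eqP; rewrite !ffunE eqxx oner_eq0.
(* One nonzero row from each idempotent [e i] gives a common eigenbasis for multiplication on the
   right: row [i] is fixed by [e i] and killed by the others. Conjugation by [R] therefore turns
   each [e i] into a diagonal unit. *)
pose R := \matrix_i nz_row (e i).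
have rowRe i j : nz_row (e i) *m e j = if i == j then nz_row (e i) else 0.
  have /submxP[a ->] := nz_row_sub (e i); rewrite -mulmxA eM.
  by case: eqP => _; rewrite ?mulmx0.
have R_unit : R \in unitmx.
  rewrite -row_free_unit; apply: inj_row_free => c cR0.
  apply/rowP => j; rewrite mxE; apply/eqP.
  have : c *m R *m e j = c 0 j *: nz_row (e j).
    rewrite (mulmx_sum_row c) mulmx_suml -(sum_if_eq j (fun i => c 0 i *: nz_row (e i))).
    apply: eq_bigr => i _; rewrite -scalemxAl rowK rowRe.
    by case: eqP => // _; rewrite scaler0.
  by rewrite cR0 mul0mx => /esym/eqP; rewrite scaler_eq0 nz_row_eq0 (negPf (e_neq0 j)) orbF.
have eE i : e i = invmx R *m delta_mx i i *m R.
  apply: (row_full_inj (A := R)); first by rewrite row_full_unit.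
  rewrite !mulmxA mulmxV // mul1mx; apply/row_matrixP => j.
  have -> : row j (delta_mx i i *m R) = if j == i then nz_row (e j) else 0.
    rewrite row_mul (_ : row j _ = if j == i then delta_mx 0 i else 0).
      by case: eqP => [->|_]; rewrite ?mul0mx // -rowE rowK.
    by apply/rowP => k; rewrite !mxE; case: eqP; rewrite !mxE ?eqxx.
  by rewrite row_mul rowK rowRe.
pose f' : {linear 'M[F]_n -> A} := f \o (mulmxr R \o mulmx (invmx R)).
have f'E X : f' X = f (invmx R *m X *m R) by [].
have f'M : {morph f' : X Y / X *m Y >-> X * Y}.
  by move=> X Y; rewrite !f'E -fM; congr (f _); rewrite !mulmxA mulmxK.
have f'S : range f' = S.
  rewrite -fS; apply/seteqP; split=> [_ [X _ <-]|_ [X _ <-]]; first by eexists.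
  by exists (R *m X *m invmx R) => //; rewrite f'E !mulmxA mulVmx // mul1mx mulmxKV.
exists n, (fun i j => f' (delta_mx i j)); split.
- by apply: matrix_units_of_morph => //; apply: morph_mx1; rewrite ?f'S.
- by rewrite units_span_of_morph.
- have gE u : g u = \sum_i u i *: f' (delta_mx i i).
    rewrite [in LHS](_ : u = \sum_i (u i : F) *: dirac i).
      by rewrite linear_sum; apply: eq_bigr => i _; rewrite linearZ_LR f'E -eE fe.
    apply/ffunP => j; rewrite sum_ffunE -(sum_if_eq j u).
    apply: eq_bigr => i _; rewrite !ffunE eq_sym; case: eqP => _.
      by rewrite [_ *: _]mulr1.
    by rewrite scaler0.
  rewrite -gH; apply/seteqP; split=> [_ [c ->]|_ [u _ <-]].
    by exists [ffun i => c i] => //; rewrite gE; apply: eq_bigr => i _; rewrite ffunE.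
  by exists u; rewrite gE.
Qed.

(** * Noncommutativity of the algebra and scalar tensor factors *)

Lemma units_span_trivial (I : finType) (E : I -> I -> A) :
  matrix_units E -> (forall i j : I, i = j) ->
  forall x, units_span E x -> exists c : F, x = c *: 1.
Proof.
move=> E_units I1 _ [c ->]; have [i0 _] := units_inhabited E_units; exists (c i0 i0).
have -> : (1 : A) = E i0 i0.
  by rewrite -E_units.2 (bigD1 i0) //= big1 ?addr0 // => i; rewrite (I1 i i0) eqxx.
rewrite (bigD1 i0) //= (bigD1 i0) //= !big1 ?addr0 // => i; by rewrite (I1 i i0) eqxx.
Qed.

(** Under commutativity [E i i = E i j * E j i = E j j], so orthogonality leaves a single index.
    Every element would then be a scalar, and a single matrix subalgebra would be everything,
    against infinite dimension. *)
Lemma noncommutative : unital_locally_matrix A -> countably_infinite_dim A ->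
  ~ (forall x y : A, x * y = y * x).
Proof.
move=> A_matrix A_dim A_comm; have [S [S1 _ S_matrix]] := A_matrix [::].
apply: (matrix_subalgebra_proper A_dim S_matrix) => z _.
have [T [T1 Tz T_matrix]] := A_matrix [:: z].
have [I [E [E_units ET]]] := matrix_units_matrix_subalgebra T1 T_matrix.
have [c ->] : exists c : F, z = c *: 1.
  apply: (units_span_trivial E_units); last by rewrite ET; apply: Tz; rewrite inE.
  move=> i j; apply/eqP; apply: contraT => ij.
  have EE : E i i = E j j by rewrite -(unitMM E_units i j i) A_comm unitMM.
  have /eqP[] := unit_neq0 E_units i i.
  by rewrite -(unitMM E_units i i i) {2}EE E_units.1 (negPf ij).
have [n _ [f [_ _ fS]]] := S_matrix.
by move: S1; rewrite -fS => -[X _ <-]; exists (c *: X); rewrite ?linearZ_LR.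
Qed.

(** Made a linear map in [x] because the universal property of the tensor product compares linear
    maps. *)
Definition commutator (b x : A) := b * x - x * b.

Lemma commutator_is_linear b : linear (commutator b).
Proof.
move=> k x y; rewrite /commutator mulrDr mulrDl -scalerAr -scalerAl scalerBr opprD.
by rewrite addrACA.
Qed.
HB.instance Definition _ b :=
  GRing.isLinear.Build F A A _ (commutator b) (commutator_is_linear b).

(* By the uniqueness part of the universal property: the commutator with b,
   composed with the multiplication map, vanishes on all pure tensors. *)
Lemma tensor_decomposition_scalar (A_ : nat -> set A) :
  tensor_decomposition A_ ->
  (forall i x, A_ i x -> exists c : F, x = c *: 1) -> forall x y : A, x * y = y * x.
Proof.
move=> [_ _ _ [T [m [m_mult _ m_full]]]] A_scalar b x.
have [k _ [z _ <-]] : (\bigcup_k range (m k)) x by rewrite m_full.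
have [t [_ /(_ A (fun=> 0))[]]] := m_mult k.
  by move=> *; rewrite scaler0 addr0.
move=> _ uniq mt; apply/eqP; rewrite -subr_eq0; apply/eqP.
apply: (uniq (commutator b \o m k) \0) => a a_in //=.
rewrite mt // /commutator.
have [c ->] : exists c : F, \prod_(j < k) a j = c *: 1.
  apply: (big_ind (fun x => exists c : F, x = c *: 1)).
  - by exists 1; rewrite scale1r.
  - by move=> _ _ [c ->] [d ->]; exists (c * d); rewrite -scalerAl mul1r scalerA.
  - by move=> j _; apply: (A_scalar j); apply: a_in.
by rewrite -scalerAl -scalerAr mulr1 mul1r subrr.
Qed.

(** * Failure of rigidity for Cartan subalgebras *)

Lemma subalgebraP (S : set A) : subalgebra S <->
  [/\ S 0, forall k x y, S x -> S y -> S (k *: x + y) & forall x y, S x -> S y -> S (x * y)].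
Proof.
split=> [[[S0 SL] SM]|[S0 SL SM]].
  split=> [|k x y Sx Sy|x y Sx Sy]; first by have := S0; rewrite inE.
    by have := SL k x y; rewrite !inE; apply.
  by have := SM x y; rewrite !inE; apply.
split; [split=> [|k x y]|move=> x y]; rewrite !inE //.
  exact: SL.
exact: SM.
Qed.

Lemma subalgebra_smallest (G : set A) : subalgebra (smallest (@subalgebra F A) G).
Proof.
apply/subalgebraP; split=> [|k x y Gx Gy|x y Gx Gy] S [S_alg GS];
  have /subalgebraP[S0 SL SM] := S_alg => //.
  by apply: SL; [apply: Gx|apply: Gy].
by apply: SM; [apply: Gx|apply: Gy].
Qed.

(** Some factor has size at least 2, since otherwise all factors are scalar and the algebra is
    commutative. For its adapted units, [E a b * h * E b a] is a multiple of [E a a] if [h] is in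
    the diagonal of that factor, and equals [h * E a a] if [h] comes from another factor. *)
Lemma cartan_subalgebra_not_rigid (H : set A) :
  unital_locally_matrix A -> countably_infinite_dim A -> cartan_subalgebra H ->
  exists u v : A, [/\ u * u = 0, u * v != 0 & forall h, H h -> H (u * h * v)].
Proof.
move=> A_matrix A_dim [A_ [H_ [A_dec H_cartan HE]]].
have [A1 _ A_comm _] := A_dec.
have H_units i : exists (n : nat) (E : 'I_n -> 'I_n -> A),
    [/\ matrix_units E, units_span E = A_ i & diag_span E = H_ i].
  exact: cartan_units (A1 i) (H_cartan i).
have : exists (i n : nat) (E : 'I_n -> 'I_n -> A) (a b : 'I_n),
    [/\ matrix_units E, units_span E = A_ i, diag_span E = H_ i & a != b].
  apply: contrapT => no_i; apply: (noncommutative A_matrix A_dim).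
  apply: (tensor_decomposition_scalar A_dec) => i x.
  have [n [E [E_units ES EH]]] := H_units i; rewrite -ES; apply: units_span_trivial => // a b.
  by apply/eqP; apply: contraT => ab; case: no_i; exists i, n, E, a, b.
move=> [i [n [E [a [b [E_units ES EH ab]]]]]].
have unitM := E_units.1.
have /subalgebraP[H0 HL HM] : subalgebra H by rewrite HE; apply: subalgebra_smallest.
have H_sub j x : H_ j x -> H x by move=> Hx; rewrite HE; apply: sub_gen_smallest; exists j.
have AE c d : A_ i (E c d) by rewrite -ES; apply: units_span_unit.
have HEaa c : H (E c c) by apply: (@H_sub i); rewrite -EH; apply: diag_span_unit.
have H_A j x : H_ j x -> A_ j x by have [k [_ _ + _]] := H_cartan j; apply.
pose u := E a b; pose v := E b a.
(* Commutation with [E b b = v * u] is included to make [K] closed under products: it gives [u * (x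
   * y) * v = (u * x * v) * (u * y * v)]. *)
pose K : set A := [set h | [/\ H h, h * E b b = E b b * h & H (u * h * v)]].
have HK : H `<=` K.
  rewrite HE; apply: smallest_sub.
    apply/subalgebraP; split.
    - by split; rewrite ?mulr0 ?mul0r.
    - move=> k x y [Hx xf ux] [Hy yf uy]; split; first exact: HL.
        by rewrite mulrDl mulrDr -scalerAl -scalerAr xf yf.
      by rewrite mulrDr mulrDl -scalerAr -scalerAl; apply: HL.
    - move=> x y [Hx xf ux] [Hy yf uy]; split; first exact: HM.
        by rewrite -mulrA yf mulrA xf mulrA.
      rewrite (_ : u * _ * v = (u * x * v) * (u * y * v)); first exact: HM.
      have -> : u * x * v * (u * y * v) = u * (x * (v * u)) * y * v by rewrite !mulrA.
      by rewrite /v /u unitMM // xf !mulrA unitMM.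
  move=> h [j _ Hh]; have [ji|ij] := pselect (i = j).
    subst j; have := Hh; rewrite -EH => -[c hE]; split; first exact: H_sub Hh.
      by apply: (diag_span_comm E_units); rewrite EH // -EH; apply: diag_span_unit.
    have -> : u * h * v = c b *: E a a + 0.
      rewrite hE mulr_sumr mulr_suml addr0 -(sum_if_eq b (fun d => c d *: E a a)).
      apply: eq_bigr => d _; rewrite -scalerAr -scalerAl /u unitM (eq_sym b).
      by case: eqP => [->|_]; rewrite ?unitMM // mul0r scaler0.
    exact: HL.
  have hE c d : h * E c d = E c d * h.
    by apply/esym; apply: (A_comm i j) => //; apply: H_A.
  split; [exact: H_sub Hh|exact: hE|].
  by rewrite -hE -mulrA unitMM //; apply: HM => //; apply: H_sub Hh.
exists u, v; split.
- by rewrite unitM eq_sym (negPf ab).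
- by rewrite unitMM // unit_neq0.
- by move=> h /HK[].
Qed.

End MatrixUnits.

(** * Arbitrarily many distinct scalars, and the conclusion *)

Lemma closed_field_injection (F : closedFieldType) (I : finType) :
  exists f : I -> F, injective f.
Proof.
have [s s_uniq s_size] : exists2 s : seq F, uniq s & size s = #|I|.
  elim: #|I| => [|n [s s_uniq s_size]]; first by exists [::].
  suff [x xs] : exists x, x \notin s by exists (x :: s); rewrite /= ?xs ?s_size.
  (* A root of the product of the ['X - a%:P] plus 1 avoids [s], since that polynomial takes the
     value 1 on [s]. For empty [s] it is constant, hence the separate case. *)
  have [s0|s_neq0] := eqVneq (size s) 0%N; first by exists 0; rewrite (size0nil s0).
  have /closed_rootP[x x_root] : size (\prod_(a <- s) ('X - a%:P) + 1 : {poly F}) != 1.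
    by rewrite size_polyDl size_prod_XsubC // size_poly1 ltnS lt0n.
  exists x; apply: contraTN x_root => xs.
  by rewrite rootE hornerD hornerC (eqP (_ : root _ x)) ?root_prod_XsubC // add0r oner_eq0.
exists (fun i => nth 0 s (enum_rank i)) => i j /eqP.
by rewrite nth_uniq ?s_size // => /eqP/val_inj/enum_rank_inj.
Qed.

Theorem theorem3 (F : closedFieldType) (A : algType F)
    (A_locally_matrix : unital_locally_matrix A)
    (A_countable_dim : countably_infinite_dim A) :
  exists H : set A, general_cartan_subalgebra H /\ ~ cartan_subalgebra H.
Proof.
have [I_ [E_ [E_units E_step E_full]]] :=
  units_span_chain (@closed_field_injection F) A_locally_matrix A_countable_dim.
exists (\bigcup_n diag_span (@E_ n)); split; first exact: general_cartan_of_units.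
move=> H_cartan.
have [u [v [uu uv uHv]]] :=
  cartan_subalgebra_not_rigid A_locally_matrix A_countable_dim H_cartan.
exact: (diag_union_rigid E_units E_step E_full uu uv uHv).
Qed.
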